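(* There is an absolute constant $C>0$ such that the following holds for each of the two protocols Snowflake and Snowball. Let $k\ge 2$ and $\alpha$ be integers with $\frac k2<\alpha\le k$ and let $g:\mathbb N\to\mathbb R_{\ge0}$ satisfy $g(n)\in o(n)$. Assume that no party decides before a state is reached in which at least $n-g(n)$ parties hold the same opinion (that is, the decision rule is disregarded up to that point). Then for all sufficiently large $n$ there is an initial assignment of opinions in $\{0,1\}$ to the $n$ parties such that the expected number of rounds until the protocol (without any adversary) first reaches such a state is at least $C\,\frac{\log n}{\log k}$; i.e. it takes $\Omega\big(\frac{\log n}{\log k}\big)$ rounds in expectation to reach a stable consensus.
   Context: In both protocols there are $n$ parties $\{1,\dots,n\}$, each holding an opinion in $\{0,1\}$. In each synchronous round every party independently draws a sample of $k$ parties uniformly at random with repetition from all $n$ parties (independently across parties and rounds) and observes the opinions these held at the end of the previous round. The query has an $\alpha$-majority for $b$ if at least $\alpha$ of the $k$ observed opinions equal $b$ (possible for at most one $b$ since $\alpha>k/2$). Opinion update in Snowflake: if the query has an $\alpha$-majority for $b$, the party's opinion becomes $b$; otherwise it is unchanged. Opinion update in Snowball: each party keeps counters $d[0],d[1]$, initially $0$. If its query has an $\alpha$-majority for $b'$, then $d[b']$ is increased by 1, and if the party's current opinion is $b\ne b'$ and now $d[b']>d[b]$, its opinion becomes $b'$. Otherwise the opinion is unchanged. (The full protocols also contain a rule, with a parameter $\beta$, by which a party irrevocably decides its opinion after $\beta$ consecutive $\alpha$-majorities for it; by the assumption in the claim this rule plays no role here.) All updates are simultaneous. The system is in a state of stable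 consensus if at least $n-o(n)$ parties hold the same opinion; here $o(n)$ is represented by the function $g$. *)

(* Defs.v *)
From HB Require Import structures.
From mathcomp Require Export all_boot all_order all_algebra.
From mathcomp Require Export all_classical all_reals all_analysis.
Export Order.TTheory GRing.Theory Num.Theory.
Export numFieldNormedType.Exports.

Set Implicit Arguments.
Unset Strict Implicit.
Unset Printing Implicit Defensive.

Local Open Scope classical_set_scope.
Local Open Scope ring_scope.

(* [alpha_majority alpha obs] is [Some b] when at least [alpha] of the [k]
   observed opinions equal [b]; such a [b] is unique as soon as [k < 2 * alpha],
   so that the choice made by [pick] is irrelevant. *)
Definition alpha_majority (k alpha : nat) (obs : 'I_k -> bool) : option bool :=
  [pick b : bool | (alpha <= #|[set j | obs j == b]%SET|)%N].

Record protocol := Protocol {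
  local_state : Type;
  init_state : bool -> local_state;
  opinion : local_state -> bool;
  (* the argument of type [option bool] is the outcome of the query *)
  update : option bool -> local_state -> local_state
}.

Definition snowflake_update (q : option bool) (b : bool) : bool :=
  if q is Some b' then b' else b.

Definition snowflake : protocol :=
  @Protocol bool (fun b => b) (fun b => b) snowflake_update.

Record snowball_state := SnowballState {
  sb_opinion : bool;
  sb_counter : bool -> nat
}.

Definition snowball_update (q : option bool) (s : snowball_state) :
    snowball_state :=
  if q is Some b' then
    let d := fun c => (sb_counter s c + (c == b'))%N in
    let b := sb_opinion s in
    SnowballState (if (b != b') && (d b < d b')%N then b' else b) d
  else s.

Definition snowball : protocol :=
  @Protocol snowball_state (fun b => SnowballState b (fun=> 0%N)) sb_opinion
    snowball_update.

(* [run p alpha sample x0 t i] is the state of party [i] at the end of round [t]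
   ([t = 0] being the initial state), where [sample t i j] is the [j]-th party
   sampled by party [i] in round [t.+1]. *)
Fixpoint run (p : protocol) (n k alpha : nat) (sample : nat -> 'I_n -> 'I_k -> 'I_n)
    (x0 : 'I_n -> bool) (t : nat) : 'I_n -> local_state p :=
  if t is t'.+1 then
    let old := run p alpha sample x0 t' in
    fun i => update (alpha_majority alpha (fun j => opinion (old (sample t' i j))))
                    (old i)
  else fun i => init_state p (x0 i).

Definition near_consensus (R : realType) (n : nat) (m : R) (x : 'I_n -> bool) :
    Prop :=
  exists b : bool, n%:R - m <= #|[set i | x i == b]%SET|%:R.

(* The infimum is [+oo] if near-consensus is never reached. *)
Definition consensus_time (R : realType) (p : protocol) (n k alpha : nat)
    (m : R) (x0 : 'I_n -> bool) (sample : nat -> 'I_n -> 'I_k -> 'I_n) : \bar R :=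
  ereal_inf [set (t%:R)%:E | t in
    [set t : nat | near_consensus m (fun i => opinion (run p alpha sample x0 t i))]].

(* Random variables take their values in a set [V] with the discrete
   sigma-algebra; a family is independent if the product rule holds for all its
   finite subfamilies. *)
Definition mutually_independent (d : measure_display) (T : measurableType d)
    (R : realType) (P : probability T R) (I : eqType) (V : Type)
    (X : I -> T -> V) : Prop :=
  forall (s : seq I) (A : I -> set V), uniq s ->
    P (\big[setI/setT]_(a <- s) (X a @^-1` A a)) =
    (\prod_(a <- s) P (X a @^-1` A a))%E.

Definition iid_uniform_samples (d : measure_display) (T : measurableType d)
    (R : realType) (P : probability T R) (n k : nat)
    (sample : T -> nat -> 'I_n -> 'I_k -> 'I_n) : Prop :=
  let X := fun (a : nat * 'I_n * 'I_k) w => sample w a.1.1 a.1.2 a.2 in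
  [/\ forall a (A : set 'I_n), measurable (X a @^-1` A),
      forall a v, P (X a @^-1` [set v]) = (n%:R^-1)%:E
    & mutually_independent P X].

(* Main.v *)
(* Draw the initial opinions as independent fair bits and write the opinion of
   party i after t rounds as a sign s_i.  Both protocols commute with exchanging
   the two opinions, so if no initial opinion influences both i and j, flipping
   those that influence i negates s_i and preserves s_j: the mean of s_i s_j over
   the initial opinions is then 0, for every fixed sequence of samples.  Hence the
   second moment of sum_i s_i is at most the sum over v of |F_v(t)|^2, where
   F_v(t) is the set of parties influenced by v.  Resampling one coordinate at a
   time, E|F_v(t)|^2 <= (k+2)^(2t).  Near-consensus forces |sum_i s_i| >= n/2, so
   by Markov's inequality and a union bound it is reached before round T with
   probability at most 4 (k+2)^(2T) / n, which is at most 1/2 for T of order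
   log n / log k; some fixed initial assignment does at least as well as the
   average one. *)
Require Import Defs.
From mathcomp Require Import zify ring lra.

Set Implicit Arguments.
Unset Strict Implicit.
Unset Printing Implicit Defensive.

Local Open Scope classical_set_scope.
Local Open Scope ring_scope.

(** * Symmetry of both protocols under exchanging the opinions *)

Lemma eq_alpha_majority (k alpha : nat) (f g : 'I_k -> bool) :
  f =1 g -> alpha_majority alpha f = alpha_majority alpha g.
Proof. by move=> fg; congr (alpha_majority alpha); apply/funext. Qed.

Lemma card_true_false (I : finType) (f : I -> bool) :
  (#|[set i | f i == true]%SET| + #|[set i | f i == false]%SET| = #|I|)%N.
Proof.
rewrite -(cardsC [set i | f i == true]%SET).
by congr addn; apply: eq_card => i; rewrite !inE; case: (f i).
Qed.

(** As [k < 2 * alpha], at most one opinion reaches [alpha], so [pick] has no choice that could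
    break the symmetry. *)
Lemma alpha_majority_negb (k alpha : nat) (obs : 'I_k -> bool) :
  (k < 2 * alpha)%N ->
  alpha_majority alpha (negb \o obs) = omap negb (alpha_majority alpha obs).
Proof.
move=> ka; pose c b := #|[set j | obs j == b]%SET|.
have cardN b : #|[set j | (negb \o obs) j == b]%SET| = c (~~ b).
  by apply: eq_card => j; rewrite !inE /=; case: (obs j); case: b.
have cardD : (c true + c false = k)%N.
  by rewrite /c card_true_false card_ord.
rewrite /alpha_majority.
case: pickP => [b|nob]; case: pickP => [b'|nob'] //=.
- rewrite cardN -/(c b'); case: b; case: b' => //=; lia.
- by rewrite cardN => h; have := nob' (~~ b); rewrite -/(c (~~ b)) h.
- by have := nob (~~ b'); rewrite cardN negbK -/(c b') => ->.
Qed.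

(** The form in which the protocols enter the bound. [flip] acts on whole local states because
    Snowball must swap its counters too. *)
Definition flip_symmetric (p : protocol)
    (flip : local_state p -> local_state p) : Prop :=
  [/\ forall b, init_state p (~~ b) = flip (init_state p b),
      forall s, opinion (flip s) = ~~ opinion s
    & forall q s, update (omap negb q) (flip s) = flip (update q s)].

Lemma snowflake_flip : flip_symmetric (p := snowflake) negb.
Proof. by split=> // -[]. Qed.

Definition snowball_flip (s : snowball_state) : snowball_state :=
  SnowballState (~~ sb_opinion s) (fun c => sb_counter s (~~ c)).

Lemma snowball_flip_symmetric : flip_symmetric (p := snowball) snowball_flip.
Proof.
split=> // -[b'|] [b d] //=.
rewrite /snowball_update /snowball_flip /= negbK; congr SnowballState.
- by case: b; case: b'; rewrite //= ?addn0; case: ifP.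
- by apply/funext => c; case: b'; case: c.
Qed.

(* The parties whose state after [t] rounds may depend on the initial opinion
   of party [v]. *)
Fixpoint influence (n k : nat) (sample : nat -> 'I_n -> 'I_k -> 'I_n) (v : 'I_n)
    (t : nat) : {set 'I_n} :=
  if t is t'.+1 then
    let F := influence sample v t' in
    [set i | (i \in F) || [exists j, sample t' i j \in F]]%SET
  else [set v]%SET.

(** * Propagation of flipped initial opinions *)

Section Run.
Variables (p : protocol) (n k alpha : nat).

Lemma eq_run (s1 s2 : nat -> 'I_n -> 'I_k -> 'I_n) (x0 : 'I_n -> bool) (T t : nat) :
  (t <= T)%N -> (forall t', (t' < T)%N -> s1 t' = s2 t') ->
  run p alpha s1 x0 t = run p alpha s2 x0 t.
Proof. by elim: t => //= t IH tT s12; rewrite (IH (ltnW tT))// s12. Qed.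

Lemma eq_influence (s1 s2 : nat -> 'I_n -> 'I_k -> 'I_n) (v : 'I_n) (T t : nat) :
  (t <= T)%N -> (forall t', (t' < T)%N -> s1 t' = s2 t') ->
  influence s1 v t = influence s2 v t.
Proof. by elim: t => //= t IH tT s12; rewrite (IH (ltnW tT))// s12. Qed.

Variables (flip : local_state p -> local_state p) (sample : nat -> 'I_n -> 'I_k -> 'I_n).
Hypotheses (flipP : flip_symmetric flip) (ka : (k < 2 * alpha)%N).

(** Whatever influences [i] one round earlier, or a party sampled by [i], influences [i]; so the
    hypothesis on [U] passes to every state that the update of [i] reads. *)
Lemma run_flip (x : 'I_n -> bool) (U : {set 'I_n}) (t : nat) (i : 'I_n) :
  let y v := (v \in U) (+) x v in
  ((forall v, i \in influence sample v t -> v \in U) ->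
     run p alpha sample y t i = flip (run p alpha sample x t i)) /\
  ((forall v, i \in influence sample v t -> v \notin U) ->
     run p alpha sample y t i = run p alpha sample x t i).
Proof.
move=> y; have [flip_init flip_opinion flip_update] := flipP.
elim: t i => [|t IH] i /=.
  split=> iU; have := iU i (set11 i); rewrite /y; last by move=> /negPf->.
  by move=> ->; rewrite addTb flip_init.
have own v : i \in influence sample v t -> i \in influence sample v t.+1.
  by rewrite /= inE => ->.
have sampled v j : sample t i j \in influence sample v t ->
    i \in influence sample v t.+1.
  by rewrite /= inE => sF; apply/orP; right; apply/existsP; exists j.
split=> iU.
- rewrite (proj1 (IH i)); last by move=> v /own; exact: iU.
  rewrite -flip_update -alpha_majority_negb//; congr update.
  apply: eq_alpha_majority => j /=.
  rewrite (proj1 (IH _)) ?flip_opinion// => v /sampled; exact: iU.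
- rewrite (proj2 (IH i)); last by move=> v /own; exact: iU.
  congr update; apply: eq_alpha_majority => j /=.
  by rewrite (proj2 (IH _))// => v /sampled; exact: iU.
Qed.

End Run.

(** * Second moment of an influence set over uniform samples *)

Lemma sum_mem (V : finType) (A : {set V}) : (\sum_v (v \in A) = #|A|)%N.
Proof. by rewrite -sum1_card [RHS]big_mkcond; apply: eq_bigr => v _; case: ifP. Qed.

Definition set_coord (I : finType) (V : Type) (w : {ffun I -> V}) (c : I) (v : V) :
    {ffun I -> V} := [ffun a => if a == c then v else w a].

Section Resample.
Variables (I V : finType) (c : I).

(* Swapping [w c] with a fresh value is a measure-preserving involution. *)
Lemma sum_resample (H : {ffun I -> V} -> nat) (F : {ffun I -> V} -> {set V}) :
  (forall w v, H (set_coord w c v) = H w) ->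
  (forall w v, F (set_coord w c v) = F w) ->
  (#|V| * (\sum_w H w * (w c \in F w)) = \sum_w H w * #|F w|)%N.
Proof.
move=> Hc Fc.
pose swap (u : {ffun I -> V} * V) := (set_coord u.1 c u.2, u.1 c).
have swapK : involutive swap.
  move=> [w v]; rewrite /swap /= [X in (_, X)]ffunE eqxx; congr pair.
  by apply/ffunP => a; rewrite !ffunE; case: eqP => // ->.
transitivity (\sum_w \sum_v H w * (v \in F w))%N; last first.
  by apply: eq_bigr => w _; rewrite -big_distrr /= sum_mem.
rewrite pair_bigA /= (reindex_inj (inv_inj swapK)) /=.
rewrite -(pair_bigA _ (fun w v => H (set_coord w c v) * (w c \in F (set_coord w c v))))%N /=.
rewrite big_distrr /=; apply: eq_bigr => w _.
by under eq_bigr do rewrite Hc Fc; rewrite sum_nat_const.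
Qed.

End Resample.

Section FiniteSample.
Variables (T n k : nat).
Let Omega := {ffun 'I_T * 'I_n * 'I_k -> 'I_n}.

(* The value [i] after round [T] is junk. *)
Definition finite_sample (w : Omega) (t : nat) (i : 'I_n) (j : 'I_k) : 'I_n :=
  if insub t is Some t' then w (t', i, j) else i.

Lemma finite_sampleE (w : Omega) (t : 'I_T) i j : finite_sample w t i j = w (t, i, j).
Proof. by rewrite /finite_sample valK. Qed.

Lemma finite_sample_set_coord (w : Omega) (t : 'I_T) c v (t' : nat) :
  (t' < t)%N -> finite_sample (set_coord w (t, c.1, c.2) v) t' = finite_sample w t'.
Proof.
move=> t't; apply/funext => i; apply/funext => j.
have t'T := ltn_trans t't (ltn_ord t).
rewrite -[t']/(val (Ordinal t'T)) !finite_sampleE ffunE !xpair_eqE.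
by rewrite -val_eqE /= ltn_eqF.
Qed.

(** Given the earlier rounds, each of the n k samples of a round hits the current set, of size a,
    with probability a/n, pairwise independently. One round thus multiplies the second moment by at
    most 1 + 2k + k(k + 1), which is below (k + 2)^2. *)
Lemma influence_second_moment (v : 'I_n) (t : nat) : (t <= T)%N ->
  (\sum_(w : Omega) #|influence (finite_sample w) v t| ^ 2 <=
     (k + 2) ^ (2 * t) * #|{: Omega}|)%N.
Proof.
elim: t => [_|t IH tT] /=.
  by rewrite muln0 expn0 mul1n; under eq_bigr do rewrite cards1; rewrite sum1_card.
have n0 : (0 < n)%N by apply: leq_ltn_trans (ltn_ord v).
apply: leq_trans (_ : (k + 2) ^ 2 * ((k + 2) ^ (2 * t) * #|{: Omega}|) <= _)%N;
  last by rewrite mulnA -expnD mulnS.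
apply: leq_trans (leq_mul (leqnn _) (IH (ltnW tT))).
pose F (w : Omega) := influence (finite_sample w) v t.
pose a (w : Omega) := #|F w|.
pose t0 := Ordinal tT.
pose b (c : 'I_n * 'I_k) (w : Omega) : nat := w (t0, c.1, c.2) \in F w.
(* Influence up to time [t] does not read the samples indexed by [t]. *)
have Fc (c : 'I_n * 'I_k) w u : F (set_coord w (t0, c.1, c.2) u) = F w.
  by apply: (@eq_influence _ _ _ _ _ t) => // t' t't; apply: (@finite_sample_set_coord _ t0).
have resample c (H : Omega -> nat) (G : Omega -> {set 'I_n}) :
    (forall w u, H (set_coord w c u) = H w) ->
    (forall w u, G (set_coord w c u) = G w) ->
    (n * (\sum_w H w * (w c \in G w)) = \sum_w H w * #|G w|)%N.
  by move=> Hc Gc; rewrite -(sum_resample Hc Gc) card_ord.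
have ab c : (n * (\sum_w a w * b c w) = \sum_w a w ^ 2)%N.
  rewrite (resample _ a F) //; last by move=> w u; rewrite /a Fc.
have aa : (\sum_w a w <= \sum_w a w ^ 2)%N.
  by apply: leq_sum => w _; case: (a w) => // m; rewrite -mulnn leq_pmulr.
(* Off the diagonal, [c'] is resampled with [b c] fixed. On it, the indicator equals its square, and
   [aa] bounds the first moment by the second. *)
have bb c c' : (n ^ 2 * (\sum_w b c w * b c' w) <= (1 + n * (c == c')) * \sum_w a w ^ 2)%N.
  rewrite -mulnn -mulnA; case: (eqVneq c c') => [<-|cc'] /=.
    rewrite (_ : \sum_w b c w * b c w = \sum_w 1 * b c w)%N; last first.
      by apply: eq_bigr => w _; rewrite /b; case: (_ \in _).
    rewrite (resample _ (fun=> 1%N) F) //.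
    under eq_bigr do rewrite mul1n.
    by rewrite muln1 leq_mul// leq_addl.
  rewrite muln0 addn0 mul1n -(ab c).
  rewrite leq_mul2l; apply/orP; right.
  rewrite (resample _ (b c) F) //; last first.
    move=> w u; rewrite /b Fc ffunE; case: eqP => // -[e1 e2].
    by case/eqP: cc'; apply/eqP; rewrite -pair_eqE /= /pair_eq /= e1 e2 !eqxx.
  by apply: leq_sum => w _; rewrite mulnC.
have step (w : Omega) : (#|influence (finite_sample w) v t.+1| <= a w + \sum_c b c w)%N.
  rewrite /= -/(F w); set E := [set i | _]%SET.
  apply: (@leq_trans (\sum_i ((i \in F w) + \sum_j b (i, j) w))).
    rewrite -sum1_card big_mkcond /=; apply: leq_sum => i _; rewrite inE.
    case: (i \in F w) => //=; rewrite add0n; case: ifP => // /existsP[j sj].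
    by rewrite (bigD1 j) //= /b /= -finite_sampleE sj.
  rewrite big_split /= leq_add //.
    by rewrite sum_mem.
  by rewrite pair_bigA /=; apply: leq_sum => -[i j] _.
(* The factor n^2 clears the denominators of the hit probabilities. *)
rewrite -(@leq_pmul2l (n ^ 2)) ?expn_gt0 ?n0 //.
apply: (@leq_trans (n ^ 2 * \sum_w (a w + \sum_c b c w) ^ 2)).
  by rewrite leq_mul2l leq_sum ?orbT // => w _; rewrite leq_sqr; exact: step.
have -> : (\sum_w (a w + \sum_c b c w) ^ 2 = \sum_w a w ^ 2 +
   2 * (\sum_c \sum_w a w * b c w) + \sum_c \sum_c' \sum_w b c w * b c' w)%N.
  rewrite exchange_big big_distrr /=.
  under [X in (_ = _ + X)%N]eq_bigr do rewrite exchange_big.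
  rewrite [X in (_ = _ + X)%N]exchange_big -!big_split /=.
  apply: eq_bigr => w _; rewrite sqrnD -big_distrr /=.
  by rewrite addnAC; congr addn; rewrite -mulnn big_distrlr.
set A := (\sum_w a w ^ 2)%N in ab aa bb *.
set X := (\sum_c \sum_w a w * b c w)%N; set Y := (\sum_c \sum_c' _)%N.
have nX : (n * X = n * k * A)%N.
  rewrite big_distrr /=; under eq_bigr do rewrite ab.
  by rewrite sum_nat_const card_prod !card_ord.
have -> : (n ^ 2 * (A + 2 * X + Y) = n ^ 2 * A + 2 * (n * (n * X)) + n ^ 2 * Y)%N by ring.
rewrite nX.
apply: (@leq_trans (n ^ 2 * A + 2 * (n * (n * k * A)) +
   \sum_(c : 'I_n * 'I_k) \sum_(c' : 'I_n * 'I_k) (1 + n * (c == c')) * A)%N).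
  rewrite leq_add2l big_distrr; apply: leq_sum => c _; rewrite big_distrr /=.
  by apply: leq_sum => c' _; exact: bb.
have -> : (\sum_(c : 'I_n * 'I_k) \sum_(c' : 'I_n * 'I_k) (1 + n * (c == c')) * A =
    n * k * (n * k + n) * A)%N.
  have <- : #|{: 'I_n * 'I_k}| = (n * k)%N by rewrite card_prod !card_ord.
  rewrite -mulnA.
  rewrite -sum_nat_const; apply: eq_bigr => c _.
  rewrite -big_distrl /= big_split /= sum_nat_const muln1.
  rewrite -big_distrr /=; congr ((_ + _) * _)%N.
  by rewrite (bigD1 c) //= eqxx big1 ?addn0 ?muln1 // => c' /negPf; rewrite eq_sym => ->.
nia.
Qed.

End FiniteSample.

(** * Second moment of the opinion sum over random initial opinions *)

Lemma sum_Posz (I : finType) (f : I -> nat) :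
  \sum_i (f i)%:Z = (\sum_i f i)%N%:Z.
Proof. by rewrite -natz natr_sum; apply: eq_bigr => i _; rewrite natz. Qed.

Section RandomStart.
Variables (p : protocol) (flip : local_state p -> local_state p) (n k alpha : nat).
Hypotheses (flipP : flip_symmetric flip) (ka : (k < 2 * alpha)%N).

Definition opinion_at (sample : nat -> 'I_n -> 'I_k -> 'I_n) (x : 'I_n -> bool)
    (t : nat) (i : 'I_n) : bool := opinion (run p alpha sample x t i).

(* If no initial opinion influences both [i] and [j], flipping the initial
   opinions that influence [i] changes the sign of each product. *)
Lemma sum_opinion_product_le (sample : nat -> 'I_n -> 'I_k -> 'I_n) (t : nat)
    (i j : 'I_n) :
  \sum_(x : {ffun 'I_n -> bool})
      (-1) ^+ opinion_at sample x t i * (-1) ^+ opinion_at sample x t j <=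
    (2 ^ n * \sum_v ((i \in influence sample v t) * (j \in influence sample v t)))%:Z.
Proof.
(* A common influencer makes the right side at least 2^n, enough for a sum of 2^n signs. *)
have [/existsP[v /andP[iv jv]]|disj] := boolP [exists v,
    (i \in influence sample v t) && (j \in influence sample v t)].
  apply: (@le_trans _ _ (\sum_(x : {ffun 'I_n -> bool}) 1)).
    apply: ler_sum => x _; rewrite -signr_addb.
    by case: (_ (+) _); rewrite ?expr0 ?expr1.
  rewrite sumr_const card_ffun card_bool card_ord -[leLHS]/((1 *+ _)) pmulrn.
  by rewrite intz lez_nat leq_pmulr // (bigD1 v) //= iv jv.
set S := (X in X <= _); suff -> : S = 0 by [].
pose U := [set v | i \in influence sample v t]%SET.
pose shift (x : {ffun 'I_n -> bool}) := [ffun v => (v \in U) (+) x v].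
have shiftK : involutive shift.
  by move=> x; apply/ffunP => v; rewrite !ffunE addbA addbb.
suff: S = - S by move: S => S; lia.
rewrite /S {1}(reindex_inj (inv_inj shiftK)) -sumrN; apply: eq_bigr => x _.
have opinionE l : opinion_at sample (shift x) t l =
    opinion (run p alpha sample (fun v => (v \in U) (+) x v) t l).
  by rewrite /opinion_at; congr (opinion (run _ _ _ _ _ _)); apply/funext => v; rewrite ffunE.
have [flip_i _] := run_flip sample flipP ka x U t i.
have [_ fix_j] := run_flip sample flipP ka x U t j.
rewrite !opinionE flip_i ?fix_j; first last.
- by move=> v; rewrite inE.
- move=> v jv; rewrite inE; apply: contra disj => iv.
  by apply/existsP; exists v; rewrite iv.
have [_ -> _] := flipP.
by rewrite -/(opinion_at _ _ _ i) signrN mulNr.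
Qed.

(** After expanding the square and exchanging sums, each [v] contributes the number of ordered pairs
    in its influence set. *)
Lemma opinion_sum_second_moment (sample : nat -> 'I_n -> 'I_k -> 'I_n) (t : nat) :
  \sum_(x : {ffun 'I_n -> bool}) (\sum_i (-1) ^+ opinion_at sample x t i) ^+ 2 <=
    (2 ^ n * \sum_v #|influence sample v t| ^ 2)%:Z.
Proof.
under [leLHS]eq_bigr do rewrite expr2 big_distrlr /=.
rewrite exchange_big; under [leLHS]eq_bigr do rewrite exchange_big.
apply: (le_trans (ler_sum _ (fun i _ => ler_sum _ (fun j _ =>
  sum_opinion_product_le sample t i j)))).
under [leLHS]eq_bigr do rewrite sum_Posz -big_distrr /=.
rewrite sum_Posz -big_distrr /= lez_nat leq_mul2l; apply/orP; right.
under eq_bigr do rewrite exchange_big.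
rewrite exchange_big; apply: leq_sum => v _.
by rewrite -mulnn -sum_mem big_distrlr.
Qed.

End RandomStart.

(** * Skewed rounds: Markov's inequality and the union bound *)

Definition skewed (n : nat) (x : 'I_n -> bool) : bool :=
  [exists b : bool, (3 * n <= 4 * #|[set i | x i == b]%SET|)%N].

(** The signs sum to n minus twice the number of [true] opinions, so agreement of three quarters
    puts the sum at distance at least n/2 from 0. *)
Lemma skewed_sum (n : nat) (x : 'I_n -> bool) :
  skewed x -> ((n ^ 2)%:Z <= 4 * (\sum_i (-1) ^+ x i) ^+ 2).
Proof.
have -> : \sum_i (-1) ^+ x i = n%:Z - 2 * (#|[set i | x i == true]%SET|)%:Z :> int.
  have -> : n%:Z = \sum_(i < n) 1 by rewrite sumr_const card_ord natz.
  rewrite -sum_mem -sum_Posz big_distrr /=.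
  rewrite -sumrB; apply: eq_bigr => i _; rewrite inE.
  by case: (x i).
case/existsP => b.
have := card_true_false x; rewrite card_ord.
case: b; move: #|_| #|_| => c c' /=; nia.
Qed.

Section GoodStart.
Variables (p : protocol) (flip : local_state p -> local_state p) (n k alpha T : nat).
Hypotheses (flipP : flip_symmetric flip) (ka : (k < 2 * alpha)%N) (n0 : (0 < n)%N).
Let Omega := {ffun 'I_T * 'I_n * 'I_k -> 'I_n}.
Let start := {ffun 'I_n -> bool}.

Definition early_skew (x : 'I_n -> bool) (w : Omega) (t : nat) : bool :=
  skewed (opinion_at p alpha (finite_sample w) x t).

(** Markov's inequality for the squared sum at threshold n^2/4, in counting form. Summing over the n
    sources of influence cancels one factor n. *)
Lemma card_early_skew (t : nat) : (t <= T)%N ->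
  (n * (\sum_(x : start) \sum_w early_skew x w t) <=
     4 * (2 ^ n * #|{: Omega}|) * (k + 2) ^ (2 * t))%N.
Proof.
move=> tT; rewrite -(@leq_pmul2l n) // mulnA mulnn exchange_big big_distrr /=.
have sample_le (w : Omega) : (n ^ 2 * (\sum_(x : start) early_skew x w t) <=
    4 * (2 ^ n * \sum_v #|influence (finite_sample w) v t| ^ 2))%N.
  rewrite big_distrr -lez_nat -sum_Posz PoszM /=.
  apply: le_trans (ler_wpM2l _ (opinion_sum_second_moment flipP ka _ _)) => //.
  rewrite big_distrr /=; apply: ler_sum => x _; rewrite /early_skew.
  case: (boolP (skewed _)) => [/skewed_sum|_]; rewrite ?muln1 // muln0.
  by rewrite mulr_ge0 // sqr_ge0.
apply: (leq_trans (leq_sum _ (fun w _ => sample_le w))).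
rewrite -!big_distrr exchange_big /=.
apply: (@leq_trans (4 * (2 ^ n * \sum_(v < n) (k + 2) ^ (2 * t) * #|{: Omega}|))).
  by rewrite !leq_mul2l leq_sum ?orbT // => v _; exact: influence_second_moment.
rewrite sum_nat_const card_ord; apply/eq_leq; ring.
Qed.

(** A geometric sum of ratio at least 2 is dominated by its next term, so the union bound over
    rounds costs no factor [T]. *)
Lemma sum_expn_le (q m : nat) : (2 <= q)%N -> (\sum_(t < m) q ^ t <= q ^ m)%N.
Proof.
move=> q2; elim: m => [|m IH]; first by rewrite big_ord0.
rewrite big_ord_recr /= expnS; apply: leq_trans (leq_mul q2 (leqnn _)).
by rewrite mul2n -addnn leq_add2r.
Qed.

(** Were every start bad for more than half of the samples, the bad pairs would exceed half of all
    pairs; the union bound allows at most a fraction 4(k + 2)^(2T)/n, which is at most 1/2. *)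
Lemma exists_good_start : (8 * (k + 2) ^ (2 * T) <= n)%N ->
  exists x : 'I_n -> bool,
    (#|{: Omega}| <= 2 * #|[set w | [forall t : 'I_T, ~~ early_skew x w t]]%SET|)%N.
Proof.
move=> Tn; pose good (x : start) := [set w | [forall t : 'I_T, ~~ early_skew x w t]]%SET.
suff /existsP[x xP] : [exists x : start, #|{: Omega}| <= 2 * #|good x|]%N by exists x.
apply: contraT => /existsPn nogood.
have cardC x : (#|good x| + #|~: good x|%SET = #|{: Omega}|)%N by exact: cardsC.
have bad_gt x : (#|{: Omega}| < 2 * #|~: good x|%SET)%N.
  by have := nogood x; have := cardC x; lia.
have bad_le x : (#|~: good x|%SET <= \sum_(t < T) \sum_w early_skew x w t)%N.
  rewrite -sum_mem exchange_big; apply: leq_sum => w _; rewrite !inE.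
  case: (boolP [forall t, _]) => // /forallPn[t]; rewrite negbK => xwt.
  by rewrite (bigD1 t) //= xwt.
have sum_gt : (2 ^ n * #|{: Omega}| < 2 * \sum_x #|~: good x|%SET)%N.
  have card_start : #|{: start}| = (2 ^ n)%N by rewrite card_ffun card_bool card_ord.
  apply: (@leq_trans (2 ^ n * #|{: Omega}|.+1)); first by rewrite ltn_pmul2l ?expn_gt0.
  by rewrite -card_start -sum_nat_const big_distrr; apply: leq_sum => x _; exact: bad_gt.
have sum_le : (n * (\sum_x #|~: good x|%SET) <=
    4 * (2 ^ n * #|{: Omega}|) * (k + 2) ^ (2 * T))%N.
  apply: (@leq_trans (n * \sum_(t < T) \sum_(x : start) \sum_w early_skew x w t)).
    by rewrite leq_mul2l exchange_big leq_sum ?orbT.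
  rewrite big_distrr /=.
  apply: (leq_trans (leq_sum _ (fun t _ => card_early_skew (ltnW (ltn_ord t))))).
  rewrite -big_distrr leq_mul2l /=; under eq_bigr do rewrite expnM.
  by rewrite expnM sum_expn_le ?orbT // addn2 -mulnn mulSn ltn_addr.
move: sum_gt sum_le Tn n0; set S := (\sum_x _)%N; set M := (2 ^ n * _)%N.
move: ((k + 2) ^ _)%N => K; nia.
Qed.

End GoodStart.

(** * From counting samples to an arbitrary probability space *)

Import HBNNSimple.

(* No measurability of [f] is required: the integral of a nonnegative function is
   a supremum over the simple functions below it. *)
Lemma integral_ge_indic (d : measure_display) (T : measurableType d) (R : realType)
    (mu : {measure set T -> \bar R}) (A : set T) (r : R) (f : T -> \bar R) :
  measurable A -> 0 <= r -> (forall x, 0 <= f x)%E ->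
  (forall x, A x -> r%:E <= f x)%E ->
  (r%:E * mu A <= \int[mu]_x f x)%E.
Proof.
move=> mA r0 f0 rf; rewrite ge0_integralTE //.
have -> : mu A = sintegral mu (indic_nnsfun R mA) by rewrite sintegral_indic.
rewrite -sintegralrM.
apply: ereal_sup_ubound; exists (scale_nnsfun (indic_nnsfun R mA) r0) => // x.
change ((r * \1_A x)%:E <= f x)%E.
have [xA|xA] := pselect (A x).
  by rewrite indicE mem_set // mulr1; exact: rf.
by rewrite indicE memNset // mulr0.
Qed.

Section SampleLaw.
Variables (R : realType) (d : measure_display) (O : measurableType d)
  (P : probability O R) (n k T : nat) (sample : O -> nat -> 'I_n -> 'I_k -> 'I_n).
Hypothesis iid : iid_uniform_samples P sample.
Let Omega := {ffun 'I_T * 'I_n * 'I_k -> 'I_n}.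

Definition early_sample (x : O) : Omega :=
  [ffun a : 'I_T * 'I_n * 'I_k => sample x a.1.1 a.1.2 a.2].

Lemma finite_sample_early (x : O) (t : nat) :
  (t < T)%N -> finite_sample (early_sample x) t = sample x t.
Proof.
move=> tT; apply/funext => i; apply/funext => j.
by rewrite -[t]/(val (Ordinal tT)) finite_sampleE ffunE.
Qed.

Let index (a : 'I_T * 'I_n * 'I_k) : nat * 'I_n * 'I_k := (val a.1.1, a.1.2, a.2).

(** An intersection over finitely many coordinates is the shape to which mutual independence
    applies; [index] turns bounded round numbers into natural ones. *)
Lemma early_sample_preimage (w : Omega) :
  early_sample @^-1` [set w] =
  \big[setI/setT]_(a <- map index (enum {: 'I_T * 'I_n * 'I_k}))
    ((fun x => sample x a.1.1 a.1.2 a.2) @^-1` [set finite_sample w a.1.1 a.1.2 a.2]).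
Proof.
rewrite -bigcap_seq; apply/seteqP; split => [x xw _ /mapP[a _ ->]|x xw] /=.
  by rewrite -xw finite_sampleE ffunE.
apply/ffunP => a; rewrite ffunE.
have /= -> := xw (index a) (map_f _ (mem_enum _ a)).
by rewrite finite_sampleE; case: a => [[]].
Qed.

Lemma measurable_early_sample (w : Omega) : measurable (early_sample @^-1` [set w]).
Proof.
have [mX _ _] := iid; rewrite early_sample_preimage.
by apply: bigsetI_measurable => a _; exact: mX.
Qed.

Lemma probability_early_sample (w : Omega) :
  P (early_sample @^-1` [set w]) = (#|{: Omega}|%:R^-1)%:E.
Proof.
have [_ unifX indepX] := iid; rewrite early_sample_preimage.
rewrite (indepX _ (fun a => [set finite_sample w a.1.1 a.1.2 a.2])); last first.
  rewrite map_inj_uniq ?enum_uniq // => -[[t i] j] -[[t' i'] j'] [tt' -> ->].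
  by rewrite (val_inj tt').
under eq_bigr do rewrite unifX.
rewrite big_map big_enum /= prodEFin prodr_const card_ffun card_ord.
by rewrite natrX exprVn.
Qed.

(** The event is a disjoint union of [#|G|] measurable cells of equal mass. *)
Lemma early_sample_event (G : {set Omega}) :
  exists A : set O, [/\ measurable A, forall x, A x -> early_sample x \in G
    & P A = (#|G|%:R / #|{: Omega}|%:R)%:E].
Proof.
pose cell (i : 'I_#|G|) := early_sample @^-1` [set enum_val i].
have mcell i : measurable (cell i) by exact: measurable_early_sample.
exists (\big[setU/set0]_i cell i); split.
- by apply: bigsetU_measurable => i _; exact: mcell.
- move=> x; rewrite -bigcup_seq => -[i _ /= ->]; exact: enum_valP.
- rewrite measure_semi_additive_ord //.
  + rewrite (eq_bigr _ (fun i _ => probability_early_sample (enum_val i))).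
    by rewrite sumEFin sumr_const card_ord mulr_natl.
  + by move=> i j _ _ [x [xi xj]]; exact/enum_val_inj/(etrans (esym xi)).
  + by apply: bigsetU_measurable => i _; exact: mcell.
Qed.

End SampleLaw.

(** * Assembling the lower bound *)

Lemma near_consensus_skewed (R : realType) (n : nat) (m : R) (x : 'I_n -> bool) :
  m <= 4^-1 * n%:R -> near_consensus m x -> skewed x.
Proof.
move=> mn [b nb]; apply/existsP; exists b.
by rewrite -(ler_nat R) !natrM; move: nb; set c := _%:R; lra.
Qed.

Lemma ln_trunc_log_le (R : realType) (k n : nat) : (1 < k)%N -> (0 < n)%N ->
  ln (n%:R : R) / ln k%:R <= (trunc_log k n).+1%:R.
Proof.
move=> k1 n0; have lnk : 0 < ln (k%:R : R) by rewrite ln_gt0 // ltr1n.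
rewrite ler_pdivrMr // mulr_natl -lnXn ?ltr0n ?(ltnW k1) //.
rewrite ler_ln ?posrE ?exprn_gt0 ?ltr0n ?(ltnW k1) //.
by rewrite -natrX ler_nat ltnW // trunc_log_ltn.
Qed.

(** With probability at least 1/2 no round before [T] is skewed, hence none is a near-consensus and
    the time is at least [T]. The start, found by counting, is fixed before the probability
    space. *)
Lemma consensus_time_lower_bound (R : realType) (p : protocol)
    (flip : local_state p -> local_state p) (n k alpha T : nat) (m : R) :
  flip_symmetric flip -> (k < 2 * alpha)%N -> (0 < n)%N ->
  m <= 4^-1 * n%:R -> (8 * (k + 2) ^ (2 * T) <= n)%N ->
  exists x0 : 'I_n -> bool,
  forall (d : measure_display) (O : measurableType d) (P : probability O R)
      (sample : O -> nat -> 'I_n -> 'I_k -> 'I_n),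
    iid_uniform_samples P sample ->
    ((T%:R / 2)%:E <= \int[P]_w consensus_time p alpha m x0 (sample w))%E.
Proof.
move=> flipP ka n0 mn Tn; have [x0 good] := exists_good_start flipP ka n0 Tn.
exists x0 => d O P sample iid.
set G := finset _ in good; have [A [mA AG PA]] := early_sample_event iid G.
apply: le_trans (_ : (T%:R%:E * P A <= _)%E).
  rewrite PA -EFinM lee_fin ler_wpM2l //.
  have card0 : 0 < #|{ffun 'I_T * 'I_n * 'I_k -> 'I_n}|%:R :> R.
    by rewrite ltr0n card_ffun card_ord expn_gt0 n0.
  rewrite ler_pdivlMr //; move: good; rewrite -(ler_nat R) natrM.
  by set a := #|_|%:R; set b := #|_|%:R; lra.
apply: integral_ge_indic => // x.
  by apply: le_ereal_inf_tmp => _ [t _ <-]; rewrite lee_fin.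
move=> /AG; rewrite inE => /forallP noskew.
apply: le_ereal_inf_tmp => _ [t /= cons <-]; rewrite lee_fin ler_nat leqNgt.
apply/negP => tT; move/(near_consensus_skewed mn): cons.
apply/negP; have := noskew (Ordinal tT); rewrite /early_skew /opinion_at /=.
(* The run up to [t] reads only samples before [t], where the finite and the given samples agree. *)
rewrite (@eq_run _ _ _ _ _ (sample x) _ t) // => t' t't.
by rewrite finite_sample_early // (ltn_trans t't).
Qed.

Theorem corollary5p6 (R : realType) :
  exists C : R, 0 < C /\
  forall p : protocol, p = snowflake \/ p = snowball ->
  forall (k alpha : nat) (g : nat -> R),
    (2 <= k)%N -> (k < 2 * alpha)%N -> (alpha <= k)%N ->
    (forall n, 0 <= g n) ->
    g =o_\oo (fun n : nat => n%:R : R) ->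
  exists N : nat, forall n : nat, (N <= n)%N ->
  exists x0 : 'I_n -> bool,
  forall (d : measure_display) (T : measurableType d) (P : probability T R)
      (sample : T -> nat -> 'I_n -> 'I_k -> 'I_n),
    iid_uniform_samples P sample ->
    ((C * (ln n%:R / ln k%:R))%:E <=
      \int[P]_w consensus_time p alpha (g n) x0 (sample w))%E.
Proof.
(* 1/32 is 1/2 times 1/16: the expectation is at least T/2, and log n / log k is at most 16 T. *)
exists (32^-1); split => // p psf k alpha g k2 ka _ g0 go.
have [flip flipP] : exists flip, flip_symmetric (p := p) flip.
  by case: psf => ->; [exists negb; exact: snowflake_flip
                      |exists snowball_flip; exact: snowball_flip_symmetric].
(* Slack n/4 is what turns near-consensus into agreement of three quarters. *)
have [N1 _ gN1] : \forall n \near \oo, `|g n| <= 4^-1 * `|n%:R : R|.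
  by move/eqoP: go; apply.
(* From [k ^ 8 <= n] follows [8 <= L] below, so that [T] is positive. *)
exists (maxn N1 (k ^ 8)) => n; rewrite geq_max => /andP[N1n kn].
have k0 : (0 < k)%N by exact: ltnW.
have n0 : (0 < n)%N by apply: leq_trans kn; rewrite expn_gt0 k0.
have gn : g n <= 4^-1 * n%:R.
  by have := gN1 n N1n; rewrite /= !ger0_norm.
pose L := trunc_log k n; pose T := (L %/ 8)%N.
have T1 : (1 <= T)%N by rewrite divn_gt0 // /L trunc_log_max.
(* The bounds 8 <= 2^(4T) and k + 2 <= k^2 put both factors below k^(4T), and k^(8T) <= k^L <= n. *)
have Tn : (8 * (k + 2) ^ (2 * T) <= n)%N.
  apply: (@leq_trans (k ^ (4 * T) * k ^ (4 * T))).
    apply: leq_mul.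
      apply: (@leq_trans (2 ^ (4 * T))); last by rewrite leq_exp2r // muln_gt0.
      by apply: (@leq_trans (2 ^ 4)) => //; rewrite leq_exp2l // leq_pmulr.
    rewrite (_ : 4 * T = 2 * (2 * T))%N; last by rewrite mulnA.
    by rewrite (expnM k) leq_exp2r ?muln_gt0 //; nia.
  rewrite -expnD; apply: leq_trans (trunc_logP k2 n0); rewrite leq_exp2l // /T -/L.
  by have := leq_divM L 8; lia.
have [x0 x0P] := consensus_time_lower_bound flipP ka n0 gn Tn.
exists x0 => d O P sample iid; apply: le_trans (x0P d O P sample iid).
rewrite lee_fin; have := ln_trunc_log_le R k2 n0; rewrite -/L => lnL.
(* L + 1 <= 8T + 8 by division, and 8 <= 8T since [T] is positive. *)
have : (L.+1 <= 16 * T)%N by have := ltn_ceil L (isT : (0 < 8)%N); lia.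
by rewrite -(ler_nat R) natrM; lra.
Qed.
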